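(* Let $G$ be a connected Lie group, $H$ a closed subgroup, and let $F=\dfrac{(\alpha+\beta)^2}{\alpha}+\beta$ be a $G$-invariant Randers changed square metric on $G/H$, where $\alpha$ is a Riemannian metric and $\beta$ a 1-form on $G/H$. Then $\alpha$ is a $G$-invariant Riemannian metric and the vector field $X$ corresponding to the 1-form $\beta$ is also $G$-invariant.
   Context: A Minkowski norm on a finite-dimensional real vector space $V$ is a function $F:V\to[0,\infty)$ that is smooth on $V\setminus\{0\}$, satisfies $F(\lambda v)=\lambda F(v)$ for all $\lambda>0$, and whose Hessian $g_{ij}(y)=\frac12 (F^2)_{y^iy^j}$ is positive definite at every $y\neq 0$. A Finsler metric on a connected smooth manifold $M$ is a function $F:TM\to[0,\infty)$, smooth on $TM\setminus\{0\}$, whose restriction to each $T_xM$ is a Minkowski norm. For a Riemannian metric one writes $\alpha(x,y)=\sqrt{a_{ij}(x)y^iy^j}$, and a 1-form is written $\beta(x,y)=b_i(x)y^i$. A Randers changed square metric is a Finsler metric of the form $F=(\alpha+\beta)^2/\alpha+\beta$. The vector field $X$ corresponding to $\beta$ is $X|_x=b^i\frac{\partial}{\partial x^i}$ with $b^i=a^{ij}b_j$, i.e. $\langle X|_x,y\rangle=\beta(x,y)$ for all $y\in T_xM$, where $\langle\,,\,\rangle$ is the inner product induced by $\alpha$. $G$ acts on $G/H$ by left translations; a metric ($F$ or $\alpha$) is $G$-invariant if every element of $G$ acts by an isometry, and $X$ is $G$-invariant if it is preserved by the differential of the action of every element of $G$. *)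

(* Defs.v *)
From HB Require Import structures.
From mathcomp Require Import all_boot all_order all_algebra generic_quotient.
From mathcomp Require Import all_classical all_reals all_analysis.
Import numFieldNormedType.Exports.
Import Order.TTheory GRing.Theory Num.Theory.

Set Implicit Arguments.
Unset Strict Implicit.
Unset Printing Implicit Defensive.

Local Open Scope classical_set_scope.
Local Open Scope ring_scope.

(* f is of class C^k on U; used only for U open and V of finite dimension,
   where C^(k+1) means differentiable with C^k directional derivatives *)
Fixpoint Ck (R : realType) (V W : normedModType R) (k : nat) (U : set V)
    (f : V -> W) : Prop :=
  match k with
  | 0%N => forall u, U u -> {for u, continuous f}
  | l.+1 => (forall u, U u -> differentiable f u) /\
            (forall v, Ck l U (fun u => 'd f u v))
  end.

Definition smooth_on (R : realType) (V W : normedModType R) (U : set V)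
  (f : V -> W) : Prop := forall k, Ck k U f.

(* chart_map and chart_inv are total; only their restrictions to the open sets
   chart_dom and chart_rng, on which they are inverse homeomorphisms, matter *)
Record chart (R : realType) (n : nat) (M : topologicalType) := Chart {
  chart_dom : set M;
  chart_map : M -> 'rV[R]_n;
  chart_inv : 'rV[R]_n -> M;
  chart_dom_open : open chart_dom;
  chart_rng_open : open (chart_map @` chart_dom);
  chart_mapK : forall x, chart_dom x -> chart_inv (chart_map x) = x;
  chart_map_continuous :
    forall x, chart_dom x -> {for x, continuous chart_map};
  chart_inv_continuous :
    forall u, (chart_map @` chart_dom) u -> {for u, continuous chart_inv} }.

Definition chart_rng R n M (c : @chart R n M) : set 'rV[R]_n :=
  chart_map c @` chart_dom c.

(* The atlas need not be maximal: the notions below do not change when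
   compatible charts are added. *)
Record smooth_structure (R : realType) (n : nat) (M : topologicalType) :=
  SmoothStructure {
  chart_index : Type;
  atlas : chart_index -> chart R n M;
  manifold_hausdorff : hausdorff_space M;
  manifold_second_countable : @second_countable M;
  atlas_cover : forall x, exists i, chart_dom (atlas i) x;
  atlas_compatible : forall i j,
    smooth_on [set u | chart_rng (atlas i) u /\
                       chart_dom (atlas j) (chart_inv (atlas i) u)]
              (chart_map (atlas j) \o chart_inv (atlas i)) }.

Section manifold.
Variables (R : realType) (n : nat) (M : topologicalType).
Variable A : smooth_structure R n M.
Implicit Types (x : M) (i j k : chart_index A).

Local Notation cdom i := (chart_dom (atlas (s:=A) i)).
Local Notation cmap i := (chart_map (atlas (s:=A) i)).
Local Notation cinv i := (chart_inv (atlas (s:=A) i)).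
Local Notation crng i := (chart_rng (atlas (s:=A) i)).

Definition chart_at x : chart_index A := projT1 (cid (atlas_cover A x)).

Lemma chart_atP x : cdom (chart_at x) x.
Proof. by rewrite /chart_at; case: cid. Qed.

Definition transition i j : 'rV[R]_n -> 'rV[R]_n := cmap j \o cinv i.

Lemma transition_differentiable i j x : cdom i x -> cdom j x ->
  differentiable (transition i j) (cmap i x).
Proof.
move=> ix jx; have [+ _] := @atlas_compatible _ _ _ A i j 1%N.
by apply; split; [exists x | rewrite chart_mapK].
Qed.

Lemma transition_near i j k x : cdom i x -> cdom j x ->
  \forall u \near cmap i x, transition i k u = (transition j k \o transition i j) u.
Proof.
move=> ix jx.
have ci : {for cmap i x, continuous (cinv i)}.
  by apply: chart_inv_continuous; exists x.
have : nbhs (cinv i (cmap i x)) (cdom j).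
  by apply: open_nbhs_nbhs; split; [exact: chart_dom_open|rewrite chart_mapK].
move/ci; rewrite /= nbhs_simpl => H; near=> u.
rewrite /transition /= chart_mapK //; near: u; exact: H.
Unshelve. all: by end_near. Qed.

Lemma transition_cocycle i j k x v : cdom i x -> cdom j x -> cdom k x ->
  'd (transition j k) (cmap j x) ('d (transition i j) (cmap i x) v) =
  'd (transition i k) (cmap i x) v.
Proof.
move=> ix jx kx.
have tij : transition i j (cmap i x) = cmap j x by rewrite /transition /= chart_mapK.
have dij := transition_differentiable ix jx.
have djk : differentiable (transition j k) (transition i j (cmap i x)).
  by rewrite tij; exact: transition_differentiable.
have e1 := deriveE v (transition_differentiable ix kx).
have e2 := near_eq_derive v (transition_near k ix jx).
have e3 := deriveE v (differentiable_comp dij djk).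
have e4 := congr1 (fun h => h v) (diff_comp dij djk).
rewrite /= tij in e4.
by apply: esym; apply: etrans (esym e1) _; apply: etrans e2 _; apply: etrans e3 e4.
Qed.

(* A tangent vector at x is the family of its coordinate vectors in the charts
   around x, related by the differentials of the transition maps; charts that
   do not contain x carry the dummy value 0. *)
Definition is_tangent x : {pred chart_index A -> 'rV[R]_n} :=
  fun v => `[< (forall i, ~ cdom i x -> v i = 0) /\
               (forall i j, cdom i x -> cdom j x ->
                  v j = 'd (transition i j) (cmap i x) (v i)) >].

Lemma is_tangent_submod_closed x : submod_closed (is_tangent x).
Proof.
split.
  by apply/asboolP; split=> // i j _ _; rewrite linear0.
move=> a u v /asboolP [u0 uE] /asboolP [v0 vE]; apply/asboolP; split.
  by move=> i ix; rewrite !fctE /= u0 // v0 // scaler0 addr0.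
by move=> i j ix jx; rewrite !fctE /= linearP (uE i j) // (vE i j).
Qed.

HB.instance Definition _ x :=
  GRing.isSubmodClosed.Build R (chart_index A -> 'rV[R]_n) (is_tangent x)
    (is_tangent_submod_closed x).

Record tangent x := Tangent {
  tangent_coord :> chart_index A -> 'rV[R]_n;
  tangentP : tangent_coord \in is_tangent x }.

HB.instance Definition _ x := [isSub for @tangent_coord x].
HB.instance Definition _ x := [Choice of tangent x by <:].
HB.instance Definition _ x := [SubChoice_isSubLmodule of tangent x by <:].

Definition tangent_of_coord x i (v : 'rV[R]_n) : chart_index A -> 'rV[R]_n :=
  fun j => if pselect (cdom i x /\ cdom j x)
           then 'd (transition i j) (cmap i x) v else 0.

Lemma tangent_of_coordP x i v : tangent_of_coord x i v \in is_tangent x.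
Proof.
apply/asboolP; split=> [j jx|j k jx kx]; rewrite /tangent_of_coord.
  by case: pselect => // -[].
have [ix|nix] := pselect (cdom i x); last first.
  by case: pselect => /= [[]//|_]; case: pselect => /= [[]//|_]; rewrite linear0.
case: pselect => /= [_|[]//]; case: pselect => /= [_|[]//].
exact/esym/transition_cocycle.
Qed.

(* the vector of T_x M whose coordinates in the chart i are v (the junk value 0
   if x is not in the domain of i) *)
Definition tvec i x (v : 'rV[R]_n) : tangent x :=
  Tangent (tangent_of_coordP x i v).

(* the coordinate vector d/dx^j at x in the chart i *)
Definition partial i x (j : 'I_n) : tangent x := tvec i x (delta_mx 0 j).

Lemma tvecE i x v : cdom i x -> tvec i x v i = v.
Proof.
move=> ix; rewrite /= /tangent_of_coord; case: pselect => /= [_|[]//].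
have e1 := deriveE v (transition_differentiable ix ix).
have e2 : 'D_v (transition i i) (cmap i x) = 'D_v id (cmap i x).
  apply: near_eq_derive.
  have : nbhs (cmap i x) (crng i).
    by apply: open_nbhs_nbhs; split; [exact: chart_rng_open|exists x].
  by apply: filterS => _ [y iy <-]; rewrite /transition /= chart_mapK.
apply: etrans (esym e1) _; apply: etrans e2 _; exact: derive_id.
Qed.

Lemma tvec_coordK i x (w : tangent x) : cdom i x -> tvec i x (w i) = w.
Proof.
move=> ix; apply/val_inj/funext => j /=; rewrite /tangent_of_coord.
have /asboolP[w0 wE] := tangentP w.
case: pselect => /= [[_ jx]|nj]; first exact/esym/wE.
by rewrite w0 // => jx; apply: nj.
Qed.

Lemma tvec_linear i x : linear (tvec i x).
Proof.
move=> a u v; apply/val_inj/funext => j /=; rewrite !fctE /= /tangent_of_coord.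
by case: pselect => /= _; [exact: linearP | rewrite scaler0 addr0].
Qed.

Record riemannian := Riemannian {
  inner : forall x, tangent x -> tangent x -> R;
  inner_sym : forall x v w, @inner x v w = inner w v;
  inner_linear : forall x a (u v w : tangent x),
    inner (a *: u + v) w = a * inner u w + inner v w;
  inner_pos : forall x (v : tangent x), v != 0 -> 0 < inner v v;
  inner_smooth : forall i (j l : 'I_n),
    smooth_on (crng i)
      (fun u => inner (partial i (cinv i u) j) (partial i (cinv i u) l) : R) }.

Definition rnorm (a : riemannian) x (y : tangent x) : R :=
  Num.sqrt (inner a y y).

Record one_form := OneForm {
  form_val : forall x, tangent x -> R;
  form_linear : forall x a (u v : tangent x),
    form_val (a *: u + v) = a * form_val u + form_val v;
  form_smooth : forall i (j : 'I_n),
    smooth_on (crng i) (fun u => form_val (partial i (cinv i u) j) : R) }.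

(* the matrix (a_ij(x)) of the metric in the chart i *)
Definition gram (a : riemannian) i x : 'M[R]_n :=
  \matrix_(j, l) inner a (partial i x j) (partial i x l).

(* b^j d/dx^j with b^j = a^(jl) b_l; by sharpP it does not depend on the chart *)
Definition sharp (a : riemannian) (b : one_form) x : tangent x :=
  let i := chart_at x in
  \sum_j (\sum_l invmx (gram a i x) j l * form_val b (partial i x l))
    *: partial i x j.

Lemma tangent_sum_partial i x (w : tangent x) : cdom i x ->
  w = \sum_j w i 0 j *: partial i x j.
Proof.
move=> ix; rewrite -[LHS](tvec_coordK w ix) [in LHS](row_sum_delta (w i)).
pose h := GRing.isLinear.Build R 'rV[R]_n (tangent x) *:%R (tvec i x)
  (tvec_linear i x).
pose L : {linear 'rV[R]_n -> tangent x} := HB.pack (tvec i x) h.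
rewrite -[tvec i x]/(L : _ -> _) linear_sum.
by apply: eq_bigr => j _; rewrite linearZ.
Qed.

Lemma inner_suml (a : riemannian) x (c : 'I_n -> R) (e : 'I_n -> tangent x)
  w : inner a (\sum_j c j *: e j) w = \sum_j c j * inner a (e j) w.
Proof.
have h0 : inner a 0 w = 0.
  have := inner_linear a 1 0 0 w; rewrite scaler0 addr0 mul1r => e0.
  by apply: (addrI (inner a 0 w)); rewrite addr0.
apply: (big_ind2 (fun u r => inner a u w = r)) => // [u r v s <- <-|j _].
  by rewrite -[u]scale1r inner_linear mul1r scale1r.
by rewrite -[_ *: _]addr0 inner_linear h0 addr0.
Qed.

Lemma form_sum (b : one_form) x (c : 'I_n -> R) (e : 'I_n -> tangent x) :
  form_val b (\sum_j c j *: e j) = \sum_j c j * form_val b (e j).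
Proof.
have h0 : form_val b (0 : tangent x) = 0.
  have := form_linear b 1 (0 : tangent x) 0; rewrite scaler0 addr0 mul1r => e0.
  by apply: (addrI (form_val b (0 : tangent x))); rewrite addr0.
apply: (big_ind2 (fun u r => form_val b u = r)) => // [u r v s <- <-|j _].
  by rewrite -[u]scale1r form_linear mul1r scale1r.
by rewrite -[_ *: _]addr0 form_linear h0 addr0.
Qed.

Lemma gram_sym (a : riemannian) i x (j l : 'I_n) : gram a i x j l = gram a i x l j.
Proof. by rewrite !mxE inner_sym. Qed.

Lemma gram_unit (a : riemannian) i x : cdom i x -> gram a i x \in unitmx.
Proof.
move=> ix; rewrite -row_free_unit -kermx_eq0; apply/rowV0P => u /sub_kermxP uG.
apply/eqP; apply/negPn/negP => u0.
have w0 : tvec i x u != 0.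
  apply: contra u0 => /eqP w0; rewrite -(tvecE u ix) w0.
  by have -> : (0 : tangent x) i = 0 by [].
have := inner_pos a w0.
rewrite [X in inner a X _](tangent_sum_partial _ ix) inner_suml.
under eq_bigr => j _.
  rewrite inner_sym [X in inner a X _](tangent_sum_partial _ ix) inner_suml.
  rewrite !tvecE //.
  have -> : \sum_j0 u 0 j0 * inner a (partial i x j0) (partial i x j) = (u *m gram a i x) 0 j.
    by rewrite mxE; apply: eq_bigr => l _; rewrite !mxE.
  rewrite uG mxE mulr0.
  over.
by rewrite big1_eq ltxx.
Qed.

Lemma sharpP (a : riemannian) (b : one_form) x (y : tangent x) :
  inner a (sharp a b x) y = form_val b y.
Proof.
rewrite /sharp; set i := chart_at x; have ix : cdom i x by exact: chart_atP.
rewrite inner_suml [in RHS](tangent_sum_partial y ix) form_sum.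
under eq_bigr => j _.
  rewrite inner_sym [X in inner a X _](tangent_sum_partial y ix) inner_suml.
  rewrite mulr_sumr; over.
rewrite exchange_big /=; apply: eq_bigr => k _.
transitivity (y i 0 k * (\sum_l (gram a i x *m invmx (gram a i x)) k l
                          * form_val b (partial i x l))).
  rewrite mulr_sumr.
  under [RHS]eq_bigr => l _ do rewrite mxE mulr_suml mulr_sumr.
  rewrite [RHS]exchange_big /=; apply: eq_bigr => j _; rewrite mulr_suml.
  apply: eq_bigr => l _; rewrite [gram a i x k j]mxE.
  by rewrite mulrCA -!mulrA; congr (_ * _); rewrite mulrA mulrC !mulrA.
rewrite mulmxV ?gram_unit // (bigD1 k) //= mxE eqxx mul1r big1 ?addr0 //.
by move=> l lk; rewrite mxE eq_sym (negbTE lk) mul0r.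
Qed.

End manifold.

(* g_ij(y) = 1/2 (F^2)_{y^i y^j} *)
Definition fundamental_tensor (R : realType) (n : nat) (f : 'rV[R]_n -> R)
    (y : 'rV[R]_n) : 'M[R]_n :=
  \matrix_(i, j) (2^-1 *
    'D_(delta_mx 0 j) (fun z => 'D_(delta_mx 0 i) (fun w => f w ^+ 2) z) y).

Record minkowski_norm (R : realType) (n : nat) (f : 'rV[R]_n -> R) : Prop := {
  minkowski_ge0 : forall y, 0 <= f y;
  minkowski_smooth : smooth_on [set y : 'rV[R]_n | y != 0] f;
  minkowski_homogeneous : forall (l : R) (y : 'rV[R]_n), 0 < l -> f (l *: y) = l * f y;
  minkowski_hessian : forall y v : 'rV[R]_n, y != 0 -> v != 0 ->
    0 < \sum_i \sum_j fundamental_tensor f y i j * v 0 i * v 0 j }.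

Record finsler (R : realType) (n : nat) (M : topologicalType)
    (A : smooth_structure R n M) (F : forall x : M, tangent A x -> R) : Prop := {
  finsler_smooth : forall i : chart_index A,
    smooth_on [set p : 'rV[R]_n * 'rV[R]_n |
                 chart_rng (atlas i) p.1 /\ p.2 != 0]
      (fun p => F _ (tvec i (chart_inv (atlas i) p.1) p.2) : R);
  finsler_minkowski : forall (i : chart_index A) x, chart_dom (atlas i) x ->
    minkowski_norm (fun y => F x (tvec i x y)) }.

(* At y = 0 the convention 0^-1 = 0 gives F(0) = 0, the value that homogeneity
   imposes. *)
Definition randers_changed_square (R : realType) (n : nat) (M : topologicalType)
    (A : smooth_structure R n M) (a : riemannian A) (b : one_form A)
    x (y : tangent A x) : R :=
  (rnorm a y + form_val b y) ^+ 2 / rnorm a y + form_val b y.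

Section maps.
Variables (R : realType) (m n p : nat) (M N P : topologicalType).
Variables (A : smooth_structure R m M) (B : smooth_structure R n N).
Variable C : smooth_structure R p P.

Definition smooth_map (f : M -> N) : Prop :=
  continuous f /\
  forall (i : chart_index A) (j : chart_index B),
    smooth_on [set u | chart_rng (atlas i) u /\
                       chart_dom (atlas j) (f (chart_inv (atlas i) u))]
      (chart_map (atlas j) \o f \o chart_inv (atlas i)).

(* smoothness on the product manifold M * N *)
Definition smooth_map2 (f : M -> N -> P) : Prop :=
  continuous (fun q : M * N => f q.1 q.2) /\
  forall (i : chart_index A) (j : chart_index B) (k : chart_index C),
    smooth_on [set q : 'rV[R]_m * 'rV[R]_n |
        [/\ chart_rng (atlas i) q.1, chart_rng (atlas j) q.2 &
            chart_dom (atlas k)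
              (f (chart_inv (atlas i) q.1) (chart_inv (atlas j) q.2))]]
      (fun q => chart_map (atlas k)
         (f (chart_inv (atlas i) q.1) (chart_inv (atlas j) q.2))).

(* df_x, computed in the selected charts around x and f x; by differentialE it
   does not depend on them when f is smooth *)
Definition differential (f : M -> N) x (v : tangent A x) : tangent B (f x) :=
  let i := chart_at A x in let j := chart_at B (f x) in
  tvec j (f x)
    ('d (chart_map (atlas j) \o f \o chart_inv (atlas i))
        (chart_map (atlas i) x) (v i)).

Lemma differentialE (f : M -> N) (i : chart_index A) (j : chart_index B) x
    (v : tangent A x) :
  smooth_map f -> chart_dom (atlas i) x -> chart_dom (atlas j) (f x) ->
  differential f v j =
  'd (chart_map (atlas j) \o f \o chart_inv (atlas i))
     (chart_map (atlas i) x) (v i).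
Proof.
move=> [cf sf] ix jx; set i0 := chart_at A x; set j0 := chart_at B (f x).
have ix0 : chart_dom (atlas i0) x by exact: chart_atP.
have jx0 : chart_dom (atlas j0) (f x) by exact: chart_atP.
pose phi k l := chart_map (atlas (s:=B) l) \o f \o chart_inv (atlas (s:=A) k).
have dphi k l : chart_dom (atlas k) x -> chart_dom (atlas l) (f x) ->
    differentiable (phi k l) (chart_map (atlas k) x).
  move=> kx lx; have [+ _] := sf k l 1%N.
  by apply; split; [exists x | rewrite chart_mapK].
have t0 : transition i i0 (chart_map (atlas i) x) = chart_map (atlas i0) x.
  by rewrite /transition /= chart_mapK.
have p0 : phi i0 j0 (chart_map (atlas i0) x) = chart_map (atlas j0) (f x).
  by rewrite /phi /= chart_mapK.
have dt := transition_differentiable ix ix0.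
have ds := transition_differentiable jx0 jx.
have d1 : differentiable (phi i0 j0 \o transition i i0) (chart_map (atlas i) x).
  by apply: differentiable_comp => //; rewrite t0; exact: dphi.
have ds' : differentiable (transition j0 j)
    ((phi i0 j0 \o transition i i0) (chart_map (atlas i) x)).
  by rewrite /= t0 p0.
have nE : \forall u \near chart_map (atlas i) x, phi i j u =
    (transition j0 j \o (phi i0 j0 \o transition i i0)) u.
  have ci : {for chart_map (atlas i) x, continuous (chart_inv (atlas i))}.
    by apply: chart_inv_continuous; exists x.
  have : nbhs (chart_inv (atlas i) (chart_map (atlas i) x))
      (chart_dom (atlas i0) `&` f @^-1` chart_dom (atlas j0)).
    rewrite chart_mapK //; apply: filterI.
      by apply: open_nbhs_nbhs; split => //; exact: chart_dom_open (atlas _).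
    have : nbhs (f x) (chart_dom (atlas j0)).
      by apply: open_nbhs_nbhs; split => //; exact: chart_dom_open (atlas _).
    exact: cf.
  move/ci; rewrite /= nbhs_simpl => H; near=> u.
  have [u0 fu0] : (chart_dom (atlas i0) `&` f @^-1` chart_dom (atlas j0))
      (chart_inv (atlas i) u) by near: u; exact: H.
  by rewrite /phi /transition /= !chart_mapK.
have e1 := deriveE (v i) (dphi i j ix jx).
have e2 := near_eq_derive (v i) nE.
have e3 := deriveE (v i) (differentiable_comp d1 ds').
have e4 := congr1 (fun h => h (v i)) (diff_comp d1 ds').
have dp' : differentiable (phi i0 j0) (transition i i0 (chart_map (atlas i) x)).
  by rewrite t0; exact: dphi.
have e5 := congr1 (fun h => h (v i)) (diff_comp dt dp').
have /asboolP[_ vE] := tangentP v.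
rewrite /= t0 p0 in e4; rewrite /= t0 in e5.
apply: esym; apply: etrans (esym e1) _; apply: etrans e2 _; apply: etrans e3 _.
apply: etrans e4 _; rewrite /differential /= /tangent_of_coord.
case: pselect => /= [_|[]//]; apply: congr1; apply: etrans e5 _.
by apply: congr1; apply: esym; exact: vE.
Unshelve. all: by end_near. Qed.

Definition submersion (f : M -> N) : Prop :=
  smooth_map f /\
  forall x (w : tangent B (f x)), exists v, differential f v = w.

End maps.

Definition diffeomorphism (R : realType) (n : nat) (M : topologicalType)
    (A : smooth_structure R n M) (f : M -> M) : Prop :=
  smooth_map A A f /\
  exists g, [/\ cancel f g, cancel g f & smooth_map A A g].

Section invariance.
Variables (R : realType) (n : nat) (M : topologicalType).
Variable A : smooth_structure R n M.

Definition finsler_isometry (F : forall x : M, tangent A x -> R)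
    (f : M -> M) : Prop :=
  diffeomorphism A f /\
  forall x (y : tangent A x), F (f x) (differential A f y) = F x y.

Definition riemannian_isometry (a : riemannian A) (f : M -> M) : Prop :=
  diffeomorphism A f /\
  forall x (v w : tangent A x),
    inner a (differential A f v) (differential A f w) = inner a v w.

Definition preserves_field (X : forall x : M, tangent A x) (f : M -> M) : Prop :=
  forall x, differential A f (X x) = X (f x).

End invariance.

#[short(type="topologicalSpaceGroupType")]
HB.structure Definition TopologicalSpaceGroup := {G of Group G & Topological G}.

Record lieGroupType (R : realType) (m : nat) := LieGroup {
  lie_sort :> topologicalSpaceGroupType;
  lie_structure : smooth_structure R m lie_sort;
  lie_mul_smooth : smooth_map2 lie_structure lie_structure lie_structure
                     (fun a b : lie_sort => (a * b)%g);
  lie_inv_smooth : smooth_map lie_structure lie_structure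
                     (fun a : lie_sort => (a^-1)%g) }.

Section homogeneous_space.
Local Open Scope quotient_scope.
Variables (G : topologicalSpaceGroupType) (H : groupClosed G).

Definition left_coset_rel : rel G := fun a b => (a^-1 * b)%g \in H.

Lemma left_coset_rel_equiv : equiv_class_of left_coset_rel.
Proof.
split=> [a|a b|b a c]; rewrite /left_coset_rel.
- by rewrite mulVg gpred1.
- by rewrite -gpredV invgM invgK.
- move=> ab bc; have := gpredM _ _ ab bc.
  by rewrite -mulgA mulVKg.
Qed.

Canonical left_coset_equiv := EquivRelPack left_coset_rel_equiv.

Definition coset_space := quotient_topology {eq_quot left_coset_equiv}.

HB.instance Definition _ := Topological.on coset_space.
HB.instance Definition _ := Quotient.on coset_space.

Definition coset_proj (a : G) : coset_space := \pi_coset_space a.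

Lemma coset_projP a b : coset_proj a = coset_proj b <-> (a^-1 * b)%g \in H.
Proof. by split=> ab; apply/(@eqmodP _ left_coset_equiv). Qed.

Definition translation (g : G) (x : coset_space) : coset_space :=
  coset_proj (g * repr x)%g.

Lemma translationE g a : translation g (coset_proj a) = coset_proj (g * a)%g.
Proof.
apply/coset_projP; rewrite invgM -mulgA mulKg.
by apply/coset_projP; rewrite /coset_proj reprK.
Qed.

End homogeneous_space.

(* For H closed, G/H with the quotient topology carries exactly one smooth
   structure whose projection G -> G/H is a smooth submersion; this is the
   manifold G/H. *)
Definition is_quotient_structure (R : realType) (m n : nat)
    (G : lieGroupType R m) (H : groupClosed G)
    (B : smooth_structure R n (coset_space H)) : Prop :=
  submersion (lie_structure G) B (@coset_proj G H).

(* Main.v *)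
Require Import Defs.
From mathcomp Require Import all_boot all_order all_algebra.
From mathcomp Require Import all_classical all_reals all_analysis.
From mathcomp Require Import ring lra.
Import numFieldNormedType.Exports.
Import Order.TTheory GRing.Theory Num.Theory.

(** Away from the zero vector F = alpha + 3 beta + beta^2 / alpha, so the odd
    part of F is 3 beta and its even part is alpha + beta^2 / alpha.  The
    differential of a translation is linear, hence it preserves both parts.
    Thus beta is invariant, and if alpha and alpha' are the lengths of a vector
    and of its image, then (alpha' - alpha) (alpha alpha' - beta^2) = 0
    ([isometry_cases]).  The invariance of alpha amounts to excluding the root
    alpha' = beta^2 / alpha whenever it differs from alpha.

    In dimension at least 2 the sign of F excludes it: F >= 0 forces
    |beta| < alpha on nonzero vectors ([changed_square_form_lt]), so that
    beta^2 < alpha alpha'.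

    In dimension 1 this bound may fail: since beta / alpha takes only two
    opposite values on a line, |beta| = 3 alpha gives a Minkowski norm.
    Connectedness is what excludes the second root there.  The squared length
    N = beta(X) of X equals beta^2 / alpha^2, a continuous function on G/H, and
    the two roots say that N(g x) is N(x) or 1 / N(x)
    ([line_isometry_sharp_form]).  A continuous function on the connected group
    G with at most two values is constant, so N is constant, and this gives
    alpha' = alpha ([line_isometry_rnorm]).

    An isometry of alpha preserves the inner product by polarization.  For the
    field X, the squared length of dg(X_x) - X_(g x) is N(g x) - N(x)
    ([isometry_sharp_defect]), so N does not decrease under g, nor under its
    inverse; the difference is therefore zero. *)

Local Open Scope classical_set_scope.
Local Open Scope ring_scope.

(** * The two lengths with the same value of F *)

(** Adding and subtracting the two equations isolates the even part
    p + s^2 / p and the odd part 3 s of the metric function; the equation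
    p + s^2 / p = q + s^2 / q factors as (p - q) (p q - s^2) = 0. *)
Lemma changed_square_eq {R : realType} {p q s t : R} : 0 < p -> 0 < q ->
  (p + s) ^+ 2 / p + s = (q + t) ^+ 2 / q + t ->
  (p - s) ^+ 2 / p - s = (q - t) ^+ 2 / q - t ->
  s = t /\ (p = q \/ p * q = s ^+ 2).
Proof.
move=> p0 q0 e1 e2.
have pn : p != 0 by rewrite gt_eqF.
have qn : q != 0 by rewrite gt_eqF.
have odd_part (r c : R) : r != 0 ->
    ((r + c) ^+ 2 / r + c) - ((r - c) ^+ 2 / r - c) = 6 * c.
  by move=> rn; field.
have st : s = t.
  have := odd_part q t qn; rewrite -e1 -e2 odd_part // => e; lra.
split=> //; subst t.
have : (p - q) * (p * q - s ^+ 2) = 0.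
  have : (p + s) ^+ 2 / p * (p * q) = (q + s) ^+ 2 / q * (p * q).
    by congr (_ * _); apply: (addIr s).
  have -> : (p + s) ^+ 2 / p * (p * q) = (p + s) ^+ 2 * q by field.
  have -> : (q + s) ^+ 2 / q * (p * q) = (q + s) ^+ 2 * p by field.
  move=> e; transitivity ((p + s) ^+ 2 * q - (q + s) ^+ 2 * p); first by ring.
  by rewrite e subrr.
by move/eqP; rewrite mulf_eq0 !subr_eq0 => /orP[/eqP|/eqP]; [left|right].
Qed.

(** * Linear algebra in one tangent space *)

Section pointwise.
Context {R : realType} {n : nat} {M : topologicalType}.
Context {A : smooth_structure R n M}.
Implicit Types (a : riemannian A) (b : one_form A) (x : M).

Lemma inner_linear_r a x c (u v w : tangent A x) :
  inner a w (c *: u + v) = c * inner a w u + inner a w v.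
Proof. by rewrite inner_sym inner_linear !(inner_sym a w). Qed.

Lemma inner0l a x (w : tangent A x) : inner a 0 w = 0.
Proof.
have := inner_linear a 1 0 0 w; rewrite scaler0 addr0 mul1r => e.
by apply: (addrI (inner a 0 w)); rewrite addr0.
Qed.

Lemma form0 b x : form_val b (0 : tangent A x) = 0.
Proof.
have := form_linear b 1 (0 : tangent A x) 0; rewrite scaler0 addr0 mul1r => e.
by apply: (addrI (form_val b (0 : tangent A x))); rewrite addr0.
Qed.

Lemma innerZl a x c (u w : tangent A x) : inner a (c *: u) w = c * inner a u w.
Proof. by rewrite -[c *: u]addr0 inner_linear inner0l addr0. Qed.

Lemma formZ b x c (u : tangent A x) : form_val b (c *: u) = c * form_val b u.
Proof. by rewrite -[c *: u]addr0 form_linear form0 addr0. Qed.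

Lemma inner_ge0 a x (v : tangent A x) : 0 <= inner a v v.
Proof.
by have [->|/(inner_pos a)/ltW //] := eqVneq v 0; rewrite inner0l.
Qed.

Lemma rnorm_gt0 a x (v : tangent A x) : v != 0 -> 0 < rnorm a v.
Proof. by move=> v0; rewrite sqrtr_gt0 inner_pos. Qed.

Lemma sqr_rnorm a x (v : tangent A x) : rnorm a v ^+ 2 = inner a v v.
Proof. by rewrite sqr_sqrtr ?inner_ge0. Qed.

Lemma rnormN a x (v : tangent A x) : rnorm a (- v) = rnorm a v.
Proof.
by rewrite /rnorm -scaleN1r innerZl inner_sym innerZl; congr Num.sqrt; ring.
Qed.

Lemma formN b x (v : tangent A x) : form_val b (- v) = - form_val b v.
Proof. by rewrite -scaleN1r formZ mulN1r. Qed.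

Lemma partial_coord i x (j k : 'I_n) : chart_dom (atlas (s:=A) i) x ->
  partial i x j i 0 k = (k == j)%:R.
Proof. by move=> ix; rewrite /partial tvecE // mxE eqxx. Qed.

Lemma tangent_neq0 i x k (v : tangent A x) : v i 0 k != 0 -> v != 0.
Proof.
apply: contra => /eqP ->.
by rewrite (_ : (0 : tangent A x) i = 0) // mxE.
Qed.

(** If beta does not vanish on the first coordinate vector, the combination of
    the first two that cancels their values does: its second coordinate is the
    nonzero value - beta(e0). *)
Lemma form_kernel b x : (1 < n)%N ->
  exists2 z : tangent A x, z != 0 & form_val b z = 0.
Proof.
move=> n1; pose i := chart_at A x.
have ix : chart_dom (atlas i) x by exact: chart_atP.
pose o0 := Ordinal (ltnW n1); pose o1 := Ordinal n1.
pose e0 := partial i x o0; pose e1 := partial i x o1.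
have [b0|b0] := eqVneq (form_val b e0) 0.
  exists e0 => //; apply: (@tangent_neq0 i x o0).
  by rewrite partial_coord // eqxx oner_eq0.
exists (form_val b e1 *: e0 + (- form_val b e0) *: e1).
  apply: (@tangent_neq0 i x o1).
  rewrite (_ : (_ + _ : tangent A x) i =
    form_val b e1 *: (e0 i) + (- form_val b e0) *: (e1 i)) //.
  rewrite !mxE !partial_coord // eqxx mulr1.
  by rewrite (_ : (o1 == o0) = false) // mulr0 add0r oppr_eq0.
by rewrite form_linear formZ; ring.
Qed.

(** If |beta| were at least alpha at v, one could move v along the kernel of
    beta, where beta keeps its value while alpha tends to infinity, until
    alpha = |beta|.  There, up to a sign, beta = - alpha, and F equals
    (alpha + beta)^2 / alpha + beta = beta < 0. *)
Lemma changed_square_form_lt a b x (v : tangent A x) : (1 < n)%N ->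
  (forall w : tangent A x, 0 <= randers_changed_square a b w) ->
  v != 0 -> form_val b v ^+ 2 < inner a v v.
Proof.
move=> n1 F0 v0; rewrite ltNge; apply/negP => le.
have [z z0 bz] := form_kernel b x n1.
have Q0 := inner_pos a v0; have C0 := inner_pos a z0.
set Q := inner a v v in le Q0; set C := inner a z z in C0.
(* t is a root of the quadratic alpha^2(v + t z) = beta(v)^2, whose reduced
   discriminant D is nonnegative because alpha^2(v) <= beta(v)^2. *)
pose d := inner a v z; pose D := d ^+ 2 + C * (form_val b v ^+ 2 - Q).
have D0 : 0 <= D.
  by rewrite addr_ge0 ?sqr_ge0 // mulr_ge0 ?subr_ge0 // ltW.
pose t := (Num.sqrt D - d) / C; pose w := t *: z + v.
have bw : form_val b w = form_val b v by rewrite form_linear bz mulr0 add0r.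
have Qw : inner a w w = form_val b w ^+ 2.
  rewrite bw inner_linear !inner_linear_r -/Q -/C -/d inner_sym -/d.
  have sD := sqr_sqrtr D0.
  have Cn : C != 0 by rewrite gt_eqF.
  have -> : t * (t * C + d) + (t * d + Q) = (Num.sqrt D ^+ 2 - d ^+ 2) / C + Q.
    by rewrite /t; field.
  by rewrite sD /D; field.
have neg (u : tangent A x) : inner a u u = form_val b u ^+ 2 ->
    form_val b u < 0 -> False.
  move=> Qu bu; have := F0 u.
  rewrite /randers_changed_square /rnorm Qu sqrtr_sqr ltr0_norm // addNr.
  by rewrite expr0n mul0r add0r leNgt bu.
have [bneg|bpos|be] := ltrgtP (form_val b w) 0.
- exact: neg Qw bneg.
- apply: (neg (- w)); last by rewrite formN oppr_lt0.
  by rewrite -sqr_rnorm rnormN sqr_rnorm Qw formN sqrrN.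
- by move: le; rewrite -bw be expr0n leNgt Q0.
Qed.

End pointwise.

(** * Maps that preserve F *)

Section isometry.
Context {R : realType} {n : nat} {M : topologicalType}.
Context {A : smooth_structure R n M} (a : riemannian A) (b : one_form A).
Variable f : M -> M.
Hypothesis fF : forall x (y : tangent A x),
  randers_changed_square a b (differential A f y) = randers_changed_square a b y.

Lemma differential_linear x c (u v : tangent A x) :
  differential A f (c *: u + v) = c *: differential A f u + differential A f v.
Proof.
rewrite /differential -tvec_linear.
rewrite (_ : (c *: u + v) _ = c *: (u (chart_at A x)) + v (chart_at A x)) //.
by rewrite linearP.
Qed.

Lemma differential0 x : differential A f (0 : tangent A x) = 0.
Proof.
have := differential_linear x 1 0 0; rewrite scaler0 addr0 scale1r => e.
by apply: (addrI (differential A f (0 : tangent A x))); rewrite addr0.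
Qed.

Lemma differentialN x (v : tangent A x) :
  differential A f (- v) = - differential A f v.
Proof.
by rewrite -scaleN1r -[_ *: _]addr0 differential_linear differential0 addr0 scaleN1r.
Qed.

(** If the image of v were 0, then F(v) = F(- v) = 0; but
    F(v) + F(- v) = 2 (alpha + beta^2 / alpha) is positive. *)
Lemma differential_neq0 x (v : tangent A x) : v != 0 -> differential A f v != 0.
Proof.
move=> v0; apply/negP => /eqP dv.
have F0 y : randers_changed_square a b (0 : tangent A y) = 0.
  by rewrite /randers_changed_square /rnorm inner0l sqrtr0 invr0 mulr0 form0 addr0.
have e1 := fF x v; have e2 := fF x (- v).
rewrite differentialN dv oppr0 F0 in e2; rewrite dv F0 in e1.
have p0 := rnorm_gt0 a x v v0.
move: e1 e2; rewrite /randers_changed_square rnormN formN.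
set p := rnorm a v in p0 *; set s := form_val b v => e1 e2.
have pn : p != 0 by rewrite gt_eqF.
have : ((p + s) ^+ 2 / p + s) + ((p - s) ^+ 2 / p - s) = 0 by rewrite -e1 -e2 addr0.
have -> : ((p + s) ^+ 2 / p + s) + ((p - s) ^+ 2 / p - s) = 2 * (p + s ^+ 2 / p).
  by field.
have : 0 <= s ^+ 2 / p by rewrite divr_ge0 ?sqr_ge0 ?ltW.
lra.
Qed.

Lemma isometry_cases x (v : tangent A x) : v != 0 ->
  form_val b v = form_val b (differential A f v) /\
  (rnorm a v = rnorm a (differential A f v) \/
   rnorm a v * rnorm a (differential A f v) = form_val b v ^+ 2).
Proof.
move=> v0; apply: changed_square_eq.
- exact: rnorm_gt0.
- exact/rnorm_gt0/differential_neq0.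
- by have := fF x v.
- by have := fF x (- v); rewrite differentialN /randers_changed_square !rnormN !formN.
Qed.

Lemma isometry_form x (v : tangent A x) :
  form_val b (differential A f v) = form_val b v.
Proof.
have [->|/isometry_cases[]//] := eqVneq v 0; by rewrite differential0 !form0.
Qed.

Lemma isometry_polarization :
  (forall x (v : tangent A x), v != 0 -> rnorm a (differential A f v) = rnorm a v) ->
  forall x (v w : tangent A x),
    inner a (differential A f v) (differential A f w) = inner a v w.
Proof.
move=> fN x v w.
have fQ (u : tangent A x) :
    inner a (differential A f u) (differential A f u) = inner a u u.
  have [->|u0] := eqVneq u 0; first by rewrite differential0 !inner0l.
  by rewrite -!sqr_rnorm fN.
have := fQ (1 *: v + w); rewrite differential_linear !inner_linear !inner_linear_r.
rewrite !fQ (inner_sym a w) (inner_sym a (differential A f w)) !mul1r; lra.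
Qed.

(** The alternative alpha alpha' = beta^2 contradicts the product of the bounds
    |beta| < alpha at v and |beta| < alpha' at its image. *)
Lemma isometry_form_rnorm : (1 < n)%N ->
  (forall x (w : tangent A x), 0 <= randers_changed_square a b w) ->
  forall x (v : tangent A x), v != 0 -> rnorm a (differential A f v) = rnorm a v.
Proof.
move=> n1 F0 x v v0; have [be [->//|pq]] := isometry_cases x v v0.
have := changed_square_form_lt a b x v n1 (F0 x) v0.
have := changed_square_form_lt a b _ _ n1 (F0 _) (differential_neq0 x v v0).
rewrite -be -!sqr_rnorm -pq.
have := rnorm_gt0 a _ _ v0; have := rnorm_gt0 a _ _ (differential_neq0 x v v0).
set p := rnorm a v; set q := rnorm a _ => q0 p0.
rewrite !expr2 (ltr_pM2r q0) (ltr_pM2l p0) => h1 h2.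
by have := lt_trans h1 h2; rewrite ltxx.
Qed.

(** Expanding the square, the cross term is <dX, X'> = beta(dX) = beta(X).
    Since the left-hand side is nonnegative, this compares the lengths of X at
    x and at its image without the surjectivity of the differential. *)
Lemma isometry_sharp_defect x :
  (forall v w : tangent A x,
    inner a (differential A f v) (differential A f w) = inner a v w) ->
  let d := (-1) *: differential A f (sharp a b x) + sharp a b (f x) in
  inner a d d = form_val b (sharp a b (f x)) - form_val b (sharp a b x).
Proof.
move=> fi /=; rewrite inner_linear !inner_linear_r fi !sharpP.
by rewrite inner_sym sharpP !isometry_form; ring.
Qed.

End isometry.

(** * Dimension one *)

Section line.
Context {R : realType} {M : topologicalType} {A : smooth_structure R 1 M}.
Context (a : riemannian A) (b : one_form A).

(** On a line X is proportional to v: this is the equality case of the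
    Cauchy-Schwarz inequality.  It expresses beta(X) through any vector, hence
    through the coordinate field of any chart. *)
Lemma line_sharp_form x (v : tangent A x) :
  form_val b (sharp a b x) * inner a v v = form_val b v ^+ 2.
Proof.
pose i := chart_at A x; have ix : chart_dom (atlas i) x by exact: chart_atP.
have span (w : tangent A x) : w = w i 0 0 *: partial i x 0.
  by rewrite [LHS](tangent_sum_partial w ix) big_ord1.
have := sharpP a b (partial i x 0).
rewrite (span v) (span (sharp a b x)); set e := partial i x 0.
rewrite !(innerZl, formZ) inner_sym innerZl => <-; ring.
Qed.

(** The field X is defined with a chart that depends on the point; in a fixed
    chart beta(X) is the quotient of smooth functions given by
    [line_sharp_form]. *)
Lemma line_sharp_form_continuous :
  continuous (fun x : M => form_val b (sharp a b x)).
Proof.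
move=> x; pose i := chart_at A x.
have ix : chart_dom (atlas i) x by exact: chart_atP.
pose e y := partial i y 0.
have ex y : chart_dom (atlas i) y -> e y != 0.
  move=> iy; apply: (@tangent_neq0 _ _ _ _ i y 0).
  by rewrite partial_coord // oner_eq0.
pose p u : R := form_val b (e (chart_inv (atlas i) u)).
pose q u : R := inner a (e (chart_inv (atlas i) u)) (e (chart_inv (atlas i) u)).
have rx : chart_rng (atlas i) (chart_map (atlas i) x) by exists x.
have cp : {for chart_map (atlas i) x, continuous p}.
  exact: (@form_smooth _ _ _ _ b i 0 0%N).
have cq : {for chart_map (atlas i) x, continuous q}.
  exact: (@inner_smooth _ _ _ _ a i 0 0 0%N).
have cc : {for chart_map (atlas i) x, continuous (fun u => p u ^+ 2 / q u)}.
  apply: (@continuousM _ _ (fun u => p u ^+ 2) (fun u => (q u)^-1)).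
    exact: (@continuousM _ _ p p).
  by apply: continuousV => //; rewrite /q chart_mapK // gt_eqF // inner_pos // ex.
have NE y : chart_dom (atlas i) y ->
    form_val b (sharp a b y) =
    ((fun u => p u ^+ 2 / q u) \o chart_map (atlas i)) y.
  move=> iy; rewrite /p /q /= chart_mapK // -line_sharp_form mulfK //.
  by rewrite gt_eqF // inner_pos // ex.
have mx : {for x, continuous (chart_map (atlas i))}.
  exact: chart_map_continuous.
rewrite /continuous_at NE //.
apply: cvg_trans (cvg_comp _ _ mx cc); apply: near_eq_cvg.
have : nbhs x (chart_dom (atlas i)).
  by apply: open_nbhs_nbhs; split; first exact: chart_dom_open.
by apply: filterS => y /NE ->.
Qed.

Variable f : M -> M.
Hypothesis fF : forall x (y : tangent A x),
  randers_changed_square a b (differential A f y) = randers_changed_square a b y.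

Let sharp_form_ratio x (v : tangent A x) : v != 0 ->
  form_val b (sharp a b x) = form_val b v ^+ 2 / rnorm a v ^+ 2.
Proof.
by move=> v0; rewrite sqr_rnorm -line_sharp_form mulfK // gt_eqF // inner_pos.
Qed.

(** When alpha alpha' = beta^2, the values beta(X) before and after are
    alpha' / alpha and alpha / alpha'. *)
Lemma line_isometry_sharp_form x :
  form_val b (sharp a b (f x)) = form_val b (sharp a b x) \/
  form_val b (sharp a b (f x)) = (form_val b (sharp a b x))^-1.
Proof.
pose i := chart_at A x; have ix : chart_dom (atlas i) x by exact: chart_atP.
have v0 : partial i x 0 != 0.
  by apply: (@tangent_neq0 _ _ _ _ i x 0); rewrite partial_coord // oner_eq0.
have w0 := differential_neq0 a b f fF x _ v0.
rewrite (sharp_form_ratio _ _ v0) (sharp_form_ratio _ _ w0).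
have p0 := rnorm_gt0 a _ _ v0; have q0 := rnorm_gt0 a _ _ w0.
have [<- [<-|<-]] := isometry_cases a b f fF x _ v0; first by left.
by right; field; rewrite !gt_eqF.
Qed.

(** In the case alpha alpha' = beta^2 the hypothesis reads
    alpha / alpha' = alpha' / alpha, so alpha = alpha'. *)
Lemma line_isometry_rnorm x :
  form_val b (sharp a b (f x)) = form_val b (sharp a b x) ->
  forall v : tangent A x, v != 0 -> rnorm a (differential A f v) = rnorm a v.
Proof.
move=> eN v v0; have w0 := differential_neq0 a b f fF x _ v0.
have p0 := rnorm_gt0 a _ _ v0; have q0 := rnorm_gt0 a _ _ w0.
move: eN; rewrite (sharp_form_ratio _ _ v0) (sharp_form_ratio _ _ w0).
have [<- [->//|<-]] := isometry_cases a b f fF x _ v0.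
set p := rnorm a v in p0 *; set q := rnorm a _ in q0 * => eN.
have pn : p != 0 by rewrite gt_eqF.
have qn : q != 0 by rewrite gt_eqF.
have e : q ^+ 2 = p ^+ 2.
  have -> : q ^+ 2 = p * q / p ^+ 2 * (p * q) by field.
  by rewrite -eN; field.
by apply/eqP; rewrite -(eqrXn2 (n := 2)) ?ltW // e.
Qed.

End line.

(** * Connectedness and the homogeneous space *)

Lemma connected_two_valued_constant {R : realType} {T : topologicalType}
    (h : T -> R) (c d : R) : connected [set: T] -> continuous h ->
  (forall t, h t = c \/ h t = d) -> forall s t, h s = h t.
Proof.
move=> cT ch hcd s t.
have /connected_intervalP hI : connected (h @` [set: T]).
  by apply: connected_continuous_connected => //; exact: continuous_subspaceT.
have no_gap u v : h u < h v -> False.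
  move=> uv; have img w : (h @` [set: T]) (h w) by exists w.
  have mid : h u <= (h u + h v) / 2 <= h v by apply/andP; split; lra.
  have [r _ hr] := hI _ _ (img u) (img v) _ mid.
  by case: (hcd u) (hcd v) (hcd r) => + [] + []; lra.
have [/no_gap[]|/no_gap[]|//] := ltrgtP (h s) (h t).
Qed.

Theorem theorem3p2 (R : realType) (m n : nat) (G : lieGroupType R m)
    (H : groupClosed G) (B : smooth_structure R n (coset_space H))
    (alpha : riemannian B) (beta : one_form B) :
  connected [set: G] ->
  closed [set h : G | h \in H] ->
  is_quotient_structure B ->
  finsler (randers_changed_square alpha beta) ->
  (forall g : G, finsler_isometry (randers_changed_square alpha beta)
                   (translation (H:=H) g)) ->
  (forall g : G, riemannian_isometry alpha (translation (H:=H) g)) /\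
  (forall g : G, preserves_field (sharp alpha beta) (translation (H:=H) g)).
Proof.
move=> cG _ qB hF giso.
have gF g := (giso g).2.
have projK (x : coset_space H) : coset_proj H (repr x) = x by exact: reprK.
have translation_onto t (y : coset_space H) :
    translation (t * (repr y)^-1)%g y = coset_proj H t.
  by rewrite -[in RHS](mulgVK (repr y) t) -translationE projK.
have F0 x (w : tangent B x) : 0 <= randers_changed_square alpha beta w.
  have := minkowski_ge0 (finsler_minkowski hF (chart_atP B x)) (w (chart_at B x)).
  by rewrite tvec_coordK //; exact: chart_atP.
have norm_inv g x (v : tangent B x) : v != 0 ->
    rnorm alpha (differential B (translation (H:=H) g) v) = rnorm alpha v.
  case: n B alpha beta qB hF giso gF F0 x v
    => [|[|n]] B alpha beta qB hF giso gF F0 x v v0.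
  - by move: v0; rewrite (tangent_sum_partial v (chart_atP B x)) big_ord0 eqxx.
  - apply: (line_isometry_rnorm _ _ _ (gF g)) => //.
    (* The function beta(X) is pulled back to G, the space that is assumed
       connected. *)
    pose N (t : G) : R := form_val beta (sharp alpha beta (coset_proj H t)).
    have cN : continuous N.
      move=> t; apply: (@continuous_comp _ _ _ (@coset_proj G H)
        (fun y => form_val beta (sharp alpha beta y))).
        exact: qB.1.1.
      exact: line_sharp_form_continuous.
    have two t : N t = form_val beta (sharp alpha beta x) \/
                 N t = (form_val beta (sharp alpha beta x))^-1.
      have := line_isometry_sharp_form _ _ _ (gF (t * (repr x)^-1)%g) x.
      by rewrite translation_onto.
    have := connected_two_valued_constant _ _ _ cG cN two (g * repr x)%g (repr x).
    by rewrite /N -translationE projK.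
  - exact: (isometry_form_rnorm _ _ _ (gF g)).
have inner_inv g := isometry_polarization _ _ (norm_inv g).
split=> g; first by split; [exact: (giso g).1 | exact: inner_inv].
(* Applied to g at x and to its inverse at g x, this gives equality. *)
have sharp_le h x : form_val beta (sharp alpha beta x) <=
    form_val beta (sharp alpha beta (translation (H:=H) h x)).
  by rewrite -subr_ge0 -(isometry_sharp_defect _ _ _ (gF h)) ?inner_ge0.
have gK x : translation (g^-1)%g (translation g x) = x :> coset_space H.
  by rewrite -(projK x) !translationE mulKg.
move=> x; apply/eqP; rewrite -subr_eq0 -oppr_eq0 opprB.
apply/negPn/negP => d0.
have := inner_pos alpha d0.
rewrite addrC -scaleN1r (isometry_sharp_defect _ _ _ (gF g)) //.
rewrite subr_gt0 ltNge.
by have := sharp_le (g^-1)%g (translation g x); rewrite gK => ->.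
Qed.
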